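(* Let $\alpha\in(0,1/2)\cup(1/2,1)$. The equation $$\frac{\partial^\alpha u}{\partial t^\alpha}=\frac{\partial^3}{\partial x^3}\left(\frac{u^2}{2}\right),\qquad x\in\mathbb{R},\ t\ge 0,$$ admits the four-dimensional linear space $W_4=\langle 1,x,x^2,x^3\rangle$ as an invariant subspace; that is, with $F[u]=\frac{\partial^3}{\partial x^3}\left(\frac{u^2}{2}\right)$, one has $F[g]\in W_4$ for every $g\in W_4$.
   Context: For linearly independent functions $f_1(x),\dots,f_n(x)$, let $W_n=\langle f_1,\dots,f_n\rangle$ be their real linear span. The space $W_n$ is called invariant under a (nonlinear) differential operator $F$ in the variable $x$ if $F[y]\in W_n$ for every $y\in W_n$. An evolution equation $\partial^\alpha u/\partial t^\alpha=F[u]$ is said to admit $W_n$ as an invariant subspace if $W_n$ is invariant under $F$. Here $\partial^\alpha/\partial t^\alpha$ is the Caputo fractional derivative in $t$ of order $\alpha$; it plays no role in the invariance condition. *)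

(* Defs.v *)
From HB Require Import structures.
From mathcomp Require Import all_boot all_order all_algebra.
From mathcomp Require Import all_classical all_reals all_analysis.

Set Implicit Arguments.
Unset Strict Implicit.
Unset Printing Implicit Defensive.

Import Order.TTheory GRing.Theory Num.Theory.
Import numFieldNormedType.Exports.

Local Open Scope classical_set_scope.
Local Open Scope ring_scope.

Definition lin_indep (R : realType) (n : nat) (f : 'I_n -> R -> R) : Prop :=
  forall c : 'I_n -> R,
    (forall x, \sum_(i < n) c i * f i x = 0) -> forall i, c i = 0.

Definition fspan (R : realType) (n : nat) (f : 'I_n -> R -> R) : set (R -> R) :=
  [set y | exists c : 'I_n -> R, forall x, y x = \sum_(i < n) c i * f i x].

(* [derive1n] is total, with a junk value where the limit does not exist; an
   operator therefore carries the set of functions on which it is defined. *)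
Record diff_operator (R : realType) := DiffOperator {
  op_dom : set (R -> R);
  op_fun :> (R -> R) -> (R -> R) }.

Definition invariant_under (R : realType) (F : diff_operator R)
    (W : set (R -> R)) : Prop :=
  forall y, W y -> op_dom F y /\ W (F y).

Definition derivable_n (R : realType) (n : nat) (f : R -> R) : Prop :=
  forall k, (k < n)%N -> forall x : R, derivable (derive1n k f) x 1.

(* F[u] = (u^2 / 2)''' *)
Definition half_square_d3 (R : realType) : diff_operator R :=
  {| op_dom := [set u | derivable_n 3 (fun x => u x ^+ 2 / 2)];
     op_fun := fun u => derive1n 3 (fun x => u x ^+ 2 / 2) |}.

Definition Gamma_fun (R : realType) (z : R) : R :=
  (\int[@lebesgue_measure R]_(s in `]0%R, +oo[) (s `^ (z - 1) * expR (- s)))%R.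

(* The Caputo derivative of order alpha, for 0 < alpha < 1 and t >= 0. *)
Definition caputo (R : realType) (alpha : R) (v : R -> R) (t : R) : R :=
  (Gamma_fun (1 - alpha))^-1 *
  (\int[@lebesgue_measure R]_(s in `]0%R, t[)
     ((t - s) `^ (- alpha) * derive1 v s))%R.

(* The evolution equation T[u(x, .)](t) = F[u(., t)](x), with T acting in t
   and F acting in x. *)
Record evolution_equation (R : realType) := EvolutionEquation {
  time_op : (R -> R) -> (R -> R);
  space_op : diff_operator R }.

Definition admits_invariant_subspace (R : realType) (E : evolution_equation R)
    (n : nat) (f : 'I_n -> R -> R) : Prop :=
  lin_indep f /\ invariant_under (space_op E) (fspan f).

Definition monomials (R : realType) (n : nat) : 'I_n -> R -> R :=
  fun i x => x ^+ i.
Arguments monomials : clear implicits.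

(* Main.v *)
(* The functions in <1, x, ..., x^(n-1)> are the evaluations of polynomials of
   degree < n, and differentiation of evaluations is formal differentiation.  If
   u is a polynomial of degree at most 3, then u^2 / 2 has degree at most 6, so
   its third derivative has degree at most 3. *)
Require Import Defs.
From HB Require Import structures.
From mathcomp Require Import all_boot all_order all_algebra.
From mathcomp Require Import all_classical all_reals all_analysis.
From mathcomp Require cauchyreals.

Set Implicit Arguments.
Unset Strict Implicit.
Unset Printing Implicit Defensive.

Import Order.TTheory GRing.Theory Num.Theory.
Import numFieldNormedType.Exports.

Local Open Scope classical_set_scope.
Local Open Scope ring_scope.

(** In characteristic zero the [size p] numbers 0, 1, 2, ... are distinct roots, more than the
    degree of a nonzero [p] allows. *)
Lemma horner_eq0 (R : numDomainType) (p : {poly R}) :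
  (forall x, p.[x] = 0) -> p = 0.
Proof.
move=> p0; apply: (@roots_geq_poly_eq0 _ p [seq i%:R | i <- iota 0 (size p)]).
- by apply/allP => x _; rewrite /root p0.
- by rewrite map_inj_uniq ?iota_uniq// => i j /eqP; rewrite eqr_nat => /eqP.
- by rewrite size_map size_iota.
Qed.

Lemma monomials_lin_indep (R : realType) n : lin_indep (monomials R n).
Proof.
move=> c c0 i.
(* [\poly_] takes coefficients indexed by [nat], so [c] is extended by 0 outside ['I_n]. *)
pose E k := if insub k is Some j then c j else 0.
have Ec (j : 'I_n) : E j = c j by rewrite /E valK.
have p0 : \poly_(k < n) E k = 0.
  apply: horner_eq0 => x; rewrite horner_poly -[RHS](c0 x).
  by apply: eq_bigr => j _; rewrite Ec.
by have := coef_poly n E i; rewrite p0 coef0 ltn_ord Ec.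
Qed.

Lemma fspan_monomialsP (R : realType) n (y : R -> R) :
  fspan (monomials R n) y <->
  exists2 p : {poly R}, (size p <= n)%N & y = horner p.
Proof.
split=> [[c yE]|[p sp ->]].
  pose E k := if insub k is Some j then c j else 0.
  exists (\poly_(k < n) E k); first exact: size_poly.
  apply/funext => x; rewrite horner_poly yE; apply: eq_bigr => j _.
  by rewrite /E valK.
by exists (fun i => p`_i) => x; rewrite (horner_coef_wide x sp).
Qed.

Lemma derive1n_horner (R : realType) k (p : {poly R}) :
  derive1n k (horner p) = horner (derivn k p).
Proof. by elim: k => [//|k IH]; rewrite derive1nS IH -derivE -derivnS. Qed.

(** Serves the [op_dom] half of [invariant_under]: each iterated derivative is again the evaluation
    of a polynomial. *)
Lemma derivable_n_horner (R : realType) n (p : {poly R}) :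
  derivable_n n (horner p).
Proof. by move=> k _ x; rewrite derive1n_horner; exact: derivable_horner. Qed.

Theorem lemma3p1 (R : realType) (alpha : R)
    (halpha : 0 < alpha < 1 / 2 \/ 1 / 2 < alpha < 1) :
  admits_invariant_subspace
    {| time_op := caputo alpha; space_op := half_square_d3 R |}
    (monomials R 4).
Proof.
split=> [|_ /fspan_monomialsP[p sp ->] /=]; first exact: monomials_lin_indep.
have -> : (fun x => p.[x] ^+ 2 / 2) = horner (2^-1 *: p ^+ 2).
  by apply/funext => x; rewrite hornerZ horner_exp mulrC.
split; first exact: derivable_n_horner.
apply/fspan_monomialsP; exists (derivn 3 (2^-1 *: p ^+ 2)).
  (* Since [size] is degree plus one, the goal becomes size at most 3 + 4 = 7 for the halved
     square. *)
  rewrite cauchyreals.size_derivn leq_subLR.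
  apply: leq_trans (size_scale_leq _ _) _.
  apply: leq_trans (size_poly_exp_leq _ _) _.
  (* The bound [((size p).-1 * 2).+1] is computed for each size from 0 to 4; it reaches 7 at size
     4. *)
  by case: (size p) sp => [|[|[|[|[|]]]]].
exact: (@derive1n_horner R 3).
Qed.
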